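(* A finitely consistent SDS $K\subseteq\mathcal P(\mathcal T)$ is finitely coherent if and only if $K=\bigcap\{K'\in\overline{\mathbf K}_{\mathrm{fin,c}}:K\subseteq K'\}$, where $\overline{\mathbf K}_{\mathrm{fin,c}}$ is the set of all complete and finitely coherent SDSes.
   Context: Let $\mathcal T$ be a non-empty set (of ''things''), $\mathrm{cl}:\mathcal P(\mathcal T)\to\mathcal P(\mathcal T)$ a closure operator (extensive, monotone, idempotent), $\mathcal T_-\subseteq\mathcal T$ a set of forbidden things, $\mathcal T_+:=\mathrm{cl}(\emptyset)$, with standing assumption $\mathcal T_+\cap\mathcal T_-=\emptyset$. For $\mathcal W\subseteq\mathcal P(\mathcal T)$, $\Sigma_{\mathcal W}$ is the set of maps $\sigma:\mathcal W\to\mathcal T$ with $\sigma(S)\in S$ for all $S\in\mathcal W$, and $\sigma(\mathcal W):=\{\sigma(S):S\in\mathcal W\}$. An SDS is any $K\subseteq\mathcal P(\mathcal T)$. It is finitely coherent if (K1) $\emptyset\notin K$; (K2) if $S_1\in K$ and $S_1\subseteq S_2\subseteq\mathcal T$ then $S_2\in K$; (K3) if $S\in K$ then $S\setminus\mathcal T_-\in K$; (K4) $\{t\}\in K$ for all $t\in\mathcal T_+$; (K5fin) for every non-empty finite $\mathcal W\subseteq K$ and every family $(t_\sigma)_{\sigma\in\Sigma_{\mathcal W}}$ with $t_\sigma\in\mathrm{cl}(\sigma(\mathcal W))$, $\{t_\sigma:\sigma\in\Sigma_{\mathcal W}\}\in K$. An SDS is finitely consistent if it is included in some finitely coherent SDS.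 An SDS $K$ is complete if for all $S_1,S_2\subseteq\mathcal T$, $S_1\cup S_2\in K$ implies $S_1\in K$ or $S_2\in K$. *)

(* Defs.v *)
From mathcomp Require Import all_boot.
From mathcomp Require Import boolp classical_sets functions cardinality.

Set Implicit Arguments.
Unset Strict Implicit.
Unset Printing Implicit Defensive.

Local Open Scope classical_set_scope.

(* The set of things is the carrier type [T]; a set of desirable sets (SDS)
   is an arbitrary [K : set (set T)]. *)

Definition closure_operator (T : Type) (cl : set T -> set T) : Prop :=
  [/\ forall A, A `<=` cl A,
      forall A B, A `<=` B -> cl A `<=` cl B
    & forall A, cl (cl A) = cl A].

(* Selections are defined on the subtype of members of [W], so that
   [range s] is the set of selected things. *)
Definition selections (T : Type) (W : set (set T)) : set (W -> T) :=
  [set s | forall S : W, val S (s S)].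
Arguments selections {T} W.

Definition finitely_coherent (T : Type) (cl : set T -> set T) (Tminus : set T)
    (K : set (set T)) : Prop :=
  [/\ ~ K set0,
      forall S1 S2 : set T, K S1 -> S1 `<=` S2 -> K S2,
      forall S : set T, K S -> K (S `\` Tminus),
      forall t : T, cl set0 t -> K [set t]
    & forall W : set (set T), W !=set0 -> finite_set W -> W `<=` K ->
      forall t : selections W -> T,
        (forall s : selections W, cl (range (val s)) (t s)) -> K (range t)].

Definition finitely_consistent (T : Type) (cl : set T -> set T)
    (Tminus : set T) (K : set (set T)) : Prop :=
  exists2 K' : set (set T), finitely_coherent cl Tminus K' & K `<=` K'.

Definition complete_sds (T : Type) (K : set (set T)) : Prop :=
  forall S1 S2 : set T, K (S1 `|` S2) -> K S1 \/ K S2.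

Definition complete_finitely_coherent (T : Type) (cl : set T -> set T)
    (Tminus : set T) : set (set (set T)) :=
  [set K | complete_sds K /\ finitely_coherent cl Tminus K].

(* Main.v *)
Require Import Defs.
From mathcomp Require Import all_boot.
From mathcomp Require Import boolp classical_sets functions cardinality.
From mathcomp Require Import filter.

Local Open Scope classical_set_scope.

(** Call a set of things a theory if it is closed and avoids the forbidden
    things. A finitely coherent SDS [K] is determined by how theories meet its
    members: [A] belongs to [K] as soon as, for some finite [W] included in [K],
    every theory that meets all members of [W] also meets [A]. So if [S0] is not
    in [K], the theories meeting given finitely many members of [K] but not [S0]
    generate a proper filter. For any ultrafilter [U] refining it, the sets that
    are met by [U]-almost all theories form a complete finitely coherent SDS
    which contains [K] but not [S0]. *)

Definition theory (T : Type) (cl : set T -> set T) (Tminus D : set T) : Prop :=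
  cl D `<=` D /\ D `&` Tminus = set0.

(** The closure of a selection from [W] either contains a forbidden thing or is a theory meeting
    every member of [W], hence meeting [A]. Picking such a thing for each selection yields, by K5, a
    member of [K] inside the union of [A] and [Tminus]; K3 then discards the forbidden things. *)
Lemma finitely_coherent_mem (T : Type) (cl : set T -> set T)
    (Tminus : set T) (K W : set (set T)) (A : set T) :
  closure_operator cl -> cl set0 `&` Tminus = set0 ->
  finitely_coherent cl Tminus K -> finite_set W -> W `<=` K ->
  (forall D, theory T cl Tminus D -> (forall S, W S -> D `&` S !=set0) ->
             D `&` A !=set0) ->
  K A.
Proof.
move=> [clE _ clK] cl0 [_ K2 K3 K4 K5] Wfin WK hitA.
(* K5 only covers non-empty [W]. For empty [W], the least theory [cl set0] meets [A], and K4 with K2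
   concludes. *)
have [W0|W0] := eqVneq W set0.
  have [||t [clt At]] := hitA (cl set0).
  - by split=> //; rewrite clK.
  - by move=> S; rewrite W0.
  - by apply: K2 (K4 t clt) _ => _ ->.
have hit (s : selections W) :
    exists t, cl (range (val s)) t /\ (A `|` Tminus) t.
  have [[t [clt Mt]]|disj] := pselect (cl (range (val s)) `&` Tminus !=set0).
    by exists t; split=> //; right.
  have [||t [clt At]] := hitA (cl (range (val s))).
  - by split; [rewrite clK|apply/nonemptyPn].
  - move=> S WS; exists (val s (SigSub (mem_set WS))); split.
      by apply: clE; exists (SigSub (mem_set WS)).
    exact: (set_mem (valP s) (SigSub (mem_set WS))).
  - by exists t; split=> //; left.
have [t tP] := choice hit.
have Kt : K (range t).
  by apply: (K5 W _ Wfin WK) => [|s]; [exact/set0P|have [] := tP s].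
apply: K2 (K3 _ Kt) _ => _ [[s _ <-] nM].
by have [_ []] := tP s.
Qed.

Lemma ultrafilter_complete_finitely_coherent (T : Type) (cl : set T -> set T)
    (Tminus : set T) (U : set_system (set T)) :
  closure_operator cl -> UltraFilter U -> U (theory T cl Tminus) ->
  complete_finitely_coherent cl Tminus [set A | U [set D | D `&` A !=set0]].
Proof.
move=> [_ clS _] UU Uth; split=> [S1 S2 /= U12|].
  (* Completeness comes from maximality: if [U]-almost all theories miss [S1] but meet the union,
     they meet [S2]. *)
  have [|UC] := in_ultra_setVsetC [set D | D `&` S1 !=set0] UU; first by left.
  right; apply: filterS (filterI U12 UC) => D [[t [Dt [S1t|S2t]]] nS1].
    by case: nS1; exists t.
  by exists t.
split=> /=.
- move=> U0; apply: (filter_not_empty U); apply: filterS U0 => D [t [_ []]].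
- by move=> S1 S2 US1 S12; apply: filterS US1 => D [t [Dt /S12 S2t]]; exists t.
- move=> S US; apply: filterS (filterI US Uth) => D [[t [Dt St]] [_ DM]].
  exists t; split=> //; split=> // Mt.
  by suff : set0 t by []; rewrite -DM.
- move=> t clt; apply: filterS Uth => D [clD _].
  by exists t; split=> //; apply/clD/(clS _ _ _ _ clt).
- move=> W _ /finite_fsetP[X WX] WU t tP.
  (* Finiteness of [W] enters here: [U] is closed under finite intersections only. *)
  have UW : U (\bigcap_(S in W) [set D | D `&` S !=set0]).
    rewrite WX; apply: filter_bigI => S SX.
    by apply: (WU S); rewrite WX.
  apply: filterS (filterI UW Uth) => D [DW [clD _]].
  (* A theory meeting every member of [W] contains all values of some selection [s]; being closed,
     it contains the thing that [t] assigns to [s]. *)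
  have hit (S : W) : exists x, (D `&` val S) x.
    exact: DW (set_mem (valP S)).
  have [s sP] := choice hit.
  have sel : selections W s by move=> S; case: (sP S).
  exists (t (SigSub (mem_set sel))); split; last by exists (SigSub (mem_set sel)).
  apply/clD/(clS _ _ _ _ (tP _)) => _ [S _ <-].
  by have [] := sP S.
Qed.

Lemma finitely_coherent_separation (T : Type) (cl : set T -> set T)
    (Tminus : set T) (K : set (set T)) (S0 : set T) :
  closure_operator cl -> cl set0 `&` Tminus = set0 ->
  finitely_coherent cl Tminus K -> ~ K S0 ->
  exists K', [/\ complete_finitely_coherent cl Tminus K', K `<=` K' & ~ K' S0].
Proof.
move=> clP cl0 cohK KS0.
pose F : set_system (set T) := [set P | exists W : set (set T),
  [/\ finite_set W, W `<=` K & forall D, theory T cl Tminus D ->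
     (forall S, W S -> D `&` S !=set0) -> ~ (D `&` S0 !=set0) -> P D]].
have PF : ProperFilter F.
  split.
    (* If [F] contained the empty set, every theory meeting all members of some finite [W] would
       meet [S0], forcing [S0] into [K]. *)
    move=> [W [Wfin WK hW]]; apply: KS0.
    apply: (finitely_coherent_mem T cl Tminus K W) => // D Dth DW.
    by apply: contrapT => /hW; apply.
  split.
  - by exists set0; split.
  - move=> P Q [V [Vfin VK hV]] [W [Wfin WK hW]].
    exists (V `|` W); split; first by rewrite finite_setU.
      by move=> S [/VK|/WK].
    move=> D Dth DVW DS0; split.
      by apply: hV => // S VS; apply: DVW; left.
    by apply: hW => // S WS; apply: DVW; right.
  - move=> P Q PQ [W [Wfin WK hW]]; exists W; split=> // D Dth DW DS0.
    exact/PQ/hW.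
have [U [UU FU]] := ultraFilterLemma PF.
exists [set A | U [set D | D `&` A !=set0]]; split.
- apply: ultrafilter_complete_finitely_coherent => //; apply: FU.
  by exists set0; split.
- move=> S KS; apply: FU; exists [set S]; split=> //; first by move=> _ ->.
  by move=> D _ DS _; apply: DS.
- move=> /= US0; apply: (filter_not_empty U).
  have UC : U [set D | ~ (D `&` S0 !=set0)] by apply: FU; exists set0; split.
  by apply: filterS (filterI US0 UC) => D [].
Qed.

Lemma finitely_coherent_bigcap (T : Type) (cl : set T -> set T)
    (Tminus : set T) (F : set (set (set T))) :
  F !=set0 -> F `<=` finitely_coherent cl Tminus ->
  finitely_coherent cl Tminus (\bigcap_(K in F) K).
Proof.
move=> [K0 FK0] Fcoh; split.
- by have [K1 _ _ _ _] := Fcoh _ FK0; move=> /(_ _ FK0).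
- move=> S1 S2 S1F S12 K FK; have [_ K2 _ _ _] := Fcoh _ FK.
  exact: K2 (S1F _ FK) S12.
- move=> S SF K FK; have [_ _ K3 _ _] := Fcoh _ FK.
  exact: K3 (SF _ FK).
- move=> t clt K FK; have [_ _ _ K4 _] := Fcoh _ FK.
  exact: K4.
- move=> W W0 Wfin WF t tP K FK; have [_ _ _ _ K5] := Fcoh _ FK.
  by apply: (K5 W) => // S /WF; apply.
Qed.

Theorem theorem7 (T : Type) (cl : set T -> set T) (Tminus : set T)
    (K : set (set T)) :
  [set: T] !=set0 ->
  closure_operator cl ->
  cl set0 `&` Tminus = set0 ->
  finitely_consistent cl Tminus K ->
  finitely_coherent cl Tminus K <->
  K = \bigcap_(K' in [set K' | complete_finitely_coherent cl Tminus K' /\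
                               K `<=` K']) K'.
Proof.
move=> _ clP cl0 [L cohL KL]; split=> [cohK|->].
  apply/seteqP; split=> [S KS K' [_ KK']|S capS]; first exact: KK'.
  apply: contrapT => KS.
  have [K' [cK' KK' K'S]] :=
    finitely_coherent_separation T cl Tminus K S clP cl0 cohK KS.
  exact: K'S (capS _ (conj cK' KK')).
(* An empty intersection would be the full power set, violating K1. Separating [set0] from [L]
   provides a complete finitely coherent SDS above [K]. *)
have L0 : ~ L set0 by case: cohL.
have [K' [cK' LK' _]] :=
  finitely_coherent_separation T cl Tminus L set0 clP cl0 cohL L0.
apply: finitely_coherent_bigcap => [|K'' [[]] //].
by exists K'; split=> // S /KL/LK'.
Qed.
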